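(* Let $p:M_G\to M$ be a Galois covering over a compact manifold $M$ with covering group $G$, and let $d$ be a metric on $M_G$ compatible with its topology and invariant with respect to the action of $G$. Let $C_d(M_G)$ be the algebra of bounded complex-valued functions on $M_G$ uniformly continuous with respect to $d$, equipped with the supremum norm. Then for every $f\in C_d(M_G)$ there is a unique continuous extension $\widehat f\in C(E(M,\beta G))$. The extended algebra $\{\widehat f: f\in C_d(M_G)\}$ coincides with $C(E(M,\beta G))$. In particular, $E(M,\beta G)$ is homeomorphic to the maximal ideal space of $C_d(M_G)$.
   Context: A Galois (regular) covering is understood with $M$ and $M_G$ connected, $G$ acting on $M_G$ by deck transformations. $\beta G$ is the Stone-Čech compactification of the discrete group $G$ (the maximal ideal space of $l^\infty(G)$); the right action of $G$ on itself by multiplication extends to a continuous right action on $\beta G$. $M_G$ is a principal fibre bundle over $M$ with discrete fibre $G$: there are a finite open covering $\mathcal{U}=\{U_i\}_{i\in I}$ of $M$ by sets homeomorphic to open Euclidean balls in some $\mathbb{R}^n$ and a locally constant cocycle $\{g_{ij}\}\in Z^1(\mathcal{U},G)$ such that $M_G$ is isomorphic to the quotient of $\bigsqcup_{i\in I}U_i\times G$ by the equivalence relation $U_i\times G\ni(x,h)\sim(x,hg_{ij})\in U_j\times G$ (for $x\in U_i\cap U_j$), with projection $p$ induced by $U_i\times G\to U_i$. $E(M,\beta G)$ is the locally trivial fibre bundle over $M$ with fibre $\beta G$ constructed by the same cocycle: the quotient of $\bigsqcup_{i\in I}U_i\times\beta G$ by $U_i\times\beta G\ni(x,\xi)\sim(x,\xi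 g_{ij})\in U_j\times\beta G$. The embedding $G\hookrightarrow\beta G$ induces an embedding of $M_G$ into $E(M,\beta G)$ as an open everywhere dense subset, and extension is meant with respect to this embedding. *)

(* Defs.v *)
From HB Require Import structures.
From mathcomp Require Import all_boot all_order all_algebra.
From mathcomp Require Import generic_quotient monoid.
From mathcomp Require Import all_classical all_reals all_analysis.
From mathcomp Require Import complex.
From mathcomp Require Import ring.

Set Implicit Arguments.
Unset Strict Implicit.
Unset Printing Implicit Defensive.

Import Order.TTheory GRing.Theory Num.Theory.
Import numFieldNormedType.Exports.

Local Open Scope classical_set_scope.
Local Open Scope ring_scope.
Local Open Scope quotient_scope.

Definition in_set_type (T : Type) (A : set T) (x : T) (Ax : A x) :
    set_type A :=
  exist (fun y => y \in A) x (mem_set Ax).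

(** * Topology *)

Definition homeomorphism (X Y : topologicalType) (f : X -> Y) : Prop :=
  continuous f /\
  exists g : Y -> X, [/\ continuous g, cancel f g & cancel g f].

Definition homeomorphic (X Y : topologicalType) : Prop :=
  exists f : X -> Y, homeomorphism f.

(* The norm of the library on ['rV[R]_n] is the sup norm, hence the explicit
   Euclidean distance. *)
Definition euclidean_ball (R : realType) (n : nat) (c : 'rV[R]_n) (r : R) :
    set 'rV[R]_n :=
  [set v | \sum_(i < n) (v 0 i - c 0 i) ^+ 2 < r ^+ 2].

Definition ball_chart (R : realType) (n : nat) (M : topologicalType)
    (U : set M) : Prop :=
  open U /\
  exists (c : 'rV[R]_n) (r : R), 0 < r /\ homeomorphic U (euclidean_ball c r).

Definition manifold (R : realType) (n : nat) (M : topologicalType) : Prop :=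
  [/\ hausdorff_space M, @second_countable M &
      forall x : M, exists2 U : set M, U x & ball_chart R n U].

(** * Galois coverings *)

Definition evenly_covered (E B : topologicalType) (p : E -> B) (U : set B) :=
  exists V : set (set E),
    [/\ p @^-1` U = \bigcup_(W in V) W,
        trivIset V id,
        (forall W, V W -> open W) &
        (forall W, V W -> exists h : W -> U,
           homeomorphism h /\ forall y : W, \val (h y) = p (\val y))].

Definition covering_map (E B : topologicalType) (p : E -> B) : Prop :=
  [/\ continuous p, range p = [set: B] &
      forall x : B, exists U : set B, [/\ open U, U x & evenly_covered p U]].

Definition deck_transformation (E B : topologicalType) (p : E -> B) :
    set (E -> E) :=
  [set t | homeomorphism t /\ forall y, p (t y) = p y].

(* [act] is an isomorphism from [G] onto the group of deck transformations,
   which acts transitively on the fibres. *)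
Definition galois_covering (E B : topologicalType) (G : groupType)
    (p : E -> B) (act : G -> E -> E) : Prop :=
  [/\ connected [set: B], connected [set: E] & covering_map p] /\
  [/\ (forall y, act 1%g y = y),
      (forall g h y, act (g * h)%g y = act g (act h y)),
      injective act,
      range act = deck_transformation p &
      forall y z, p y = p z -> exists g, act g y = z].

(** * Algebras of functions and their maximal ideal spaces *)

(* [R[i]^o] is [R[i]] with the topology given by its modulus. *)

Definition bounded_function (R : realType) (X : Type) : set (X -> R[i]^o) :=
  [set f | exists K : R, forall x, `|f x| <= (K%:C)%C].

Definition bounded_unif_continuous (R : realType) (X : uniformType) :
    set (X -> R[i]^o) :=
  [set f | bounded_function f /\ unif_continuous f].

Definition subalgebra (R : realType) (X : Type) (A : set (X -> R[i]^o)) :=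
  [/\ A (fun=> 1),
      (forall f g, A f -> A g -> A (fun x => f x + g x)),
      (forall (c : R[i]) f, A f -> A (fun x => c * f x)) &
      (forall f g, A f -> A g -> A (fun x => (f x : R[i]) * g x))].

Lemma bounded_function_subalgebra (R : realType) (X : Type) :
  subalgebra (@bounded_function R X).
Proof.
split.
- by exists 1 => x; rewrite normr1.
- move=> f g [K fK] [L gL]; exists (K + L) => x.
  by rewrite rmorphD (le_trans (ler_normD _ _))// lerD.
- move=> c f [K fK]; exists (complex.Re `|c| * K) => x.
  have cE : ((complex.Re `|c|)%:C)%C = `|c| by rewrite RRe_real ?normr_real.
  by rewrite normrM rmorphM; rewrite [X in X * _]cE ler_wpM2l.
- move=> f g [K fK] [L gL]; exists (K * L) => x.
  by rewrite rmorphM /= normrM ler_pM.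
Qed.

Lemma unif_continuousCP (R : realType) (X : uniformType) (f : X -> R[i]^o) :
  unif_continuous f <->
  forall e : R, 0 < e ->
    \forall u \near entourage, `|f u.1 - f u.2| < (e%:C)%C.
Proof.
split=> [fU e e0|fE A].
  have eC : 0 < (e%:C)%C :> R[i] by rewrite ltcR.
  exact: (fU _ (entourage_ball R[i]^o (PosNum eC))).
rewrite -entourage_ballE => -[e /= e0 eA].
have eE : ((complex.Re e)%:C)%C = e by rewrite RRe_real ?gtr0_real.
have Re0 : 0 < complex.Re e by rewrite -ltcR eE.
apply: filterS (fE _ Re0) => u ue; apply: eA.
by rewrite /ball /= eE in ue *.
Qed.

Lemma bounded_functionP (R : realType) (X : Type) (f : X -> R[i]^o) :
  bounded_function f -> exists2 K : R, 0 < K & forall x, `|f x| <= (K%:C)%C.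
Proof.
move=> [K fK]; exists (`|K| + 1) => [|x]; first by rewrite ltr_wpDl.
by apply: (le_trans (fK x)); rewrite lecR (le_trans (ler_norm K))// lerDl.
Qed.

Lemma bounded_unif_continuous_subalgebra (R : realType) (X : uniformType) :
  subalgebra (@bounded_unif_continuous R X).
Proof.
have [b1 bD bZ bM] := @bounded_function_subalgebra R X.
have uM f g : @bounded_unif_continuous R X f ->
    @bounded_unif_continuous R X g ->
    @bounded_unif_continuous R X (fun x => (f x : R[i]) * g x).
  move=> [bf /unif_continuousCP uf] [bg /unif_continuousCP ug].
  split; first exact: bM.
  have [K K0 fK] := bounded_functionP bf.
  have [L L0 gL] := bounded_functionP bg.
  apply/unif_continuousCP => e e0.
  have e1 : 0 < e / (2 * L) by rewrite divr_gt0 ?mulr_gt0.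
  have e2 : 0 < e / (2 * K) by rewrite divr_gt0 ?mulr_gt0.
  apply: filterS2 (uf _ e1) (ug _ e2) => u fu gu /=.
  have -> : (f u.1 : R[i]) * g u.1 - (f u.2 : R[i]) * g u.2 =
      ((f u.1 : R[i]) - f u.2) * g u.1 +
      (f u.2 : R[i]) * ((g u.1 : R[i]) - g u.2).
    by rewrite mulrBl mulrBr addrA subrK.
  have eE : (e%:C)%C = ((e / (2 * L))%:C)%C * (L%:C)%C
      + (K%:C)%C * ((e / (2 * K))%:C)%C.
    rewrite -!rmorphM -rmorphD /=; congr (_%:C)%C.
    by field; rewrite !gt_eqF.
  rewrite eE (le_lt_trans (ler_normD _ _))// !normrM ltr_leD//.
    by rewrite (le_lt_trans (ler_wpM2l _ (gL _)))// ltr_pM2r// ltcR.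
  by rewrite ler_pM// ltW.
have u1 (k : R[i]) : @bounded_unif_continuous R X (fun=> k).
  split; first by exists (complex.Re `|k|) => x; rewrite RRe_real ?normr_real.
  apply/unif_continuousCP => e e0; apply: filterE => u /=.
  by rewrite subrr normr0 ltcR.
split=> //.
- move=> f g [bf /unif_continuousCP uf] [bg /unif_continuousCP ug].
  split; first exact: bD.
  apply/unif_continuousCP => e e0.
  have e2 : 0 < e / 2 by rewrite divr_gt0.
  apply: filterS2 (uf _ e2) (ug _ e2) => u fu gu /=.
  have eE : (e%:C)%C = ((e / 2)%:C)%C + ((e / 2)%:C)%C :> R[i].
    by rewrite -rmorphD -splitr.
  by rewrite opprD addrACA eE (le_lt_trans (ler_normD _ _))// ltrD.
- by move=> k f uf; exact: (uM _ _ (u1 k) uf).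
Qed.

(* Nonzero multiplicative linear functionals; the operations of [A] are those
   of the ambient algebra of functions. When [A] is a Banach algebra for the
   supremum norm, these functionals are automatically continuous. *)
Definition character (R : realType) (X : Type) (A : set (X -> R[i]^o)) :
    set {ptws A -> R[i]^o} :=
  [set phi |
    [/\ (forall f g h : A, (forall x, \val h x = \val f x + \val g x) ->
           phi h = phi f + phi g),
        (forall (c : R[i]) (f h : A), (forall x, \val h x = c * \val f x) ->
           phi h = c * phi f),
        (forall f g h : A,
           (forall x, \val h x = (\val f x : R[i]) * \val g x) ->
           phi h = (phi f : R[i]) * phi g) &
        exists f, phi f != 0]].

(* The Gelfand topology is that of pointwise convergence on [A]. *)
Definition maximal_ideal_space (R : realType) (X : Type)
    (A : set (X -> R[i]^o)) : topologicalType :=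
  set_type (@character R X A).

Lemma maximal_ideal_space_continuousP (R : realType) (X : Type)
    (A : set (X -> R[i]^o)) (Y : topologicalType)
    (f : Y -> maximal_ideal_space A) :
  continuous f <-> forall a : A, continuous (fun y => \val (f y) a : R[i]^o).
Proof.
split=> [fc a y|fc].
  have vc : continuous (set_val : maximal_ideal_space A -> {ptws A -> R[i]^o}).
    exact: initial_continuous.
  have vf : {for y, continuous
      (fun z => set_val (f z) : {ptws A -> R[i]^o})}.
    exact: (@continuous_comp _ _ _ f _ y (fc y) (vc (f y))).
  have pc := @proj_continuous A (fun=> R[i]^o : topologicalType) a.
  exact: (@continuous_comp _ _ _ _ _ y vf (pc _)).
have cw : continuous (fun y => set_val (f y) : {ptws A -> R[i]^o}).
  move=> y; apply/cvg_sup => a; apply: (@continuous_comp_initial _ _ _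
    (fun g : A -> R[i]^o => g a) (fun y => set_val (f y))).
  exact: fc.
exact: (@continuous_comp_initial (set_type (@character R X A)) Y
  {ptws A -> R[i]^o} set_val f cw).
Qed.

(** * The Stone-Cech compactification of a discrete group *)

Definition beta (R : realType) (G : groupType) : topologicalType :=
  maximal_ideal_space (@bounded_function R G).

Section Beta.
Variables (R : realType) (G : groupType).

Local Notation linf := (@bounded_function R G).

Lemma bounded_function_rtrans (a : linf) (g : G) :
  linf (fun h => \val a (h * g)%g).
Proof.
by case: a => a /= /set_mem [K aK]; exists K => x; exact: aK.
Qed.

Definition rtrans_linf (a : linf) (g : G) : linf :=
  in_set_type (bounded_function_rtrans a g).

Lemma beta_ract_subproof (xi : beta R G) (g : G) :
  @character R G linf (fun a => \val xi (rtrans_linf a g)).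
Proof.
case: xi => xi /= /set_mem [xiD xiZ xiM [f xif]]; split.
- by move=> a b c abc; apply: xiD => x; exact: abc.
- by move=> c a b ab; apply: xiZ => x; exact: ab.
- by move=> a b c abc; apply: xiM => x; exact: abc.
- exists (rtrans_linf f g^-1%g).
  suff -> : rtrans_linf (rtrans_linf f g^-1%g) g = f by [].
  by apply: val_inj; apply: funext => h /=; rewrite mulgK.
Qed.

(* The right action [(xi g)(a) = xi (h |-> a (h g))], which restricts to right
   multiplication on [G] by [beta_ract_unit]. *)
Definition beta_ract (xi : beta R G) (g : G) : beta R G :=
  in_set_type (beta_ract_subproof xi g).

Lemma beta_unit_subproof (h : G) : @character R G linf (fun a => \val a h).
Proof.
split => //.
have b1 : linf (fun=> 1 : R[i]^o) by exists 1 => x; rewrite normr1.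
by exists (in_set_type b1); exact: oner_neq0.
Qed.

(* The embedding of [G] into its compactification: evaluation at [h]. *)
Definition beta_unit (h : G) : beta R G := in_set_type (beta_unit_subproof h).

Lemma beta_ract1 (xi : beta R G) : beta_ract xi 1%g = xi.
Proof.
apply: val_inj; apply: funext => a /=; congr (\val xi _).
by apply: val_inj; apply: funext => h /=; rewrite mulg1.
Qed.

Lemma beta_ractM (xi : beta R G) (g h : G) :
  beta_ract xi (g * h)%g = beta_ract (beta_ract xi g) h.
Proof.
apply: val_inj; apply: funext => a /=; congr (\val xi _).
by apply: val_inj; apply: funext => k /=; rewrite mulgA.
Qed.

Lemma beta_ract_unit (h g : G) :
  beta_ract (beta_unit h) g = beta_unit (h * g)%g.
Proof. exact: val_inj. Qed.

Lemma beta_ract_continuous (g : G) : continuous (beta_ract ^~ g).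
Proof.
apply/maximal_ideal_space_continuousP => a.
have idc : continuous (@id (beta R G)) by move=> x; exact: cvg_id.
exact: ((maximal_ideal_space_continuousP _).1 idc (rtrans_linf a g)).
Qed.

End Beta.

(** * Fibre bundles defined by a locally constant cocycle *)

Record right_action (G : groupType) (F : Type) := RightAction {
  ract :> F -> G -> F;
  ract1 : forall xi, ract xi 1%g = xi;
  ractM : forall xi g h, ract xi (g * h)%g = ract (ract xi g) h }.

Definition group_right_action (G : groupType) :
    right_action G (discrete_topology G) :=
  @RightAction G (discrete_topology G) (fun h g => (h * g)%g)
    (@mulg1 G) (@mulgA G).

Definition beta_right_action (R : realType) (G : groupType) :
    right_action G (beta R G) :=
  RightAction (@beta_ract1 R G) (@beta_ractM R G).

(* The values of [cocycle_map i j] outside [chart i `&` chart j] are junk. *)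
Record cocycle (G : groupType) (M : topologicalType) (I : finType) := Cocycle {
  chart : I -> set M;
  chart_open : forall i, open (chart i);
  chart_setT : \bigcup_i chart i = [set: M];
  cocycle_map : I -> I -> M -> G;
  cocycle_locally_constant : forall i j x, chart i x -> chart j x ->
    \forall y \near x, cocycle_map i j y = cocycle_map i j x;
  cocycleP : forall i j k x, chart i x -> chart j x -> chart k x ->
    (cocycle_map i j x * cocycle_map j k x)%g = cocycle_map i k x }.

Section Bundle.
Variables (G : groupType) (M : topologicalType) (I : finType).
Variables (c : cocycle G M I) (F : topologicalType) (a : right_action G F).

Definition bundle_total : topologicalType :=
  {i : I & (set_type (chart c i) * F)%type}.

Definition bundle_glue : rel bundle_total := fun u v =>
  `[< \val (tagged u).1 = \val (tagged v).1 /\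
      (tagged v).2 =
        a (tagged u).2 (cocycle_map c (tag u) (tag v) (\val (tagged u).1)) >].

Lemma chart_val (i : I) (x : set_type (chart c i)) : chart c i (\val x).
Proof. by case: x => x /= /set_mem. Qed.

Lemma cocycle_id (i : I) (x : M) : chart c i x -> cocycle_map c i i x = 1%g.
Proof.
by move=> ix; have /(congr1 (fun g => (cocycle_map c i i x)^-1 * g)%g) :=
  cocycleP ix ix ix; rewrite mulKg mulVg.
Qed.

Lemma bundle_glue_refl : reflexive bundle_glue.
Proof.
move=> [i [x xi]]; apply/asboolP; split => //=.
by rewrite cocycle_id ?ract1 //; exact: chart_val.
Qed.

Lemma bundle_glue_trans : transitive bundle_glue.
Proof.
move=> [j [y eta]] [i [x xi]] [k [z zeta]].
move=> /asboolP /= [xy ->] /asboolP /= [yz ->]; apply/asboolP => /=.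
split; first by rewrite xy.
rewrite -ractM -xy cocycleP //; first exact: chart_val.
- by rewrite xy; exact: chart_val.
- by rewrite xy yz; exact: chart_val.
Qed.

Lemma bundle_glue_sym : symmetric bundle_glue.
Proof.
suff H u v : bundle_glue u v -> bundle_glue v u.
  by move=> u v; apply/idP/idP; exact: H.
case: u v => [i [x xi]] [j [y eta]].
move=> /asboolP /= [xy ->]; apply/asboolP => /=; split=> //.
rewrite -ractM -xy cocycleP ?cocycle_id ?ract1 //; try exact: chart_val.
by rewrite xy; exact: chart_val.
Qed.

Definition bundle_equiv : equiv_rel bundle_total :=
  EquivRel bundle_glue bundle_glue_refl bundle_glue_sym bundle_glue_trans.

Definition bundle : topologicalType :=
  quotient_topology {eq_quot bundle_equiv}.

(* The class of the point [(x, xi)] of [chart c i * F]. *)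
Definition bundle_pt (i : I) (x : set_type (chart c i)) (xi : F) : bundle :=
  \pi_({eq_quot bundle_equiv})
    (existT (fun i => (set_type (chart c i) * F)%type) i (x, xi)).

Lemma bundle_ptP (i j : I) (x : set_type (chart c i))
    (y : set_type (chart c j)) (xi eta : F) :
  bundle_pt x xi = bundle_pt y eta <->
  \val x = \val y /\ eta = a xi (cocycle_map c i j (\val x)).
Proof.
split=> [/eqmodP/asboolP //|H].
by apply/eqmodP/asboolP.
Qed.

Lemma bundle_ptW (e : bundle) :
  exists i (x : set_type (chart c i)) xi, e = bundle_pt x xi.
Proof.
rewrite -[e]reprK; case: (repr e) => i [x xi].
by exists i, x, xi.
Qed.

End Bundle.

Section Embedding.
Variables (R : realType) (G : groupType) (M : topologicalType) (I : finType).
Variable c : cocycle G M I.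

Definition group_bundle : topologicalType := bundle c (group_right_action G).

(* The bundle [E(M, beta G)]. *)
Definition beta_bundle : topologicalType := bundle c (beta_right_action R G).

Definition group_bundle_pt (i : I) (x : set_type (chart c i)) (h : G) :
    group_bundle :=
  bundle_pt (group_right_action G) x h.

Definition beta_bundle_pt (i : I) (x : set_type (chart c i)) (xi : beta R G) :
    beta_bundle :=
  bundle_pt (beta_right_action R G) x xi.

Definition bundle_embed (e : group_bundle) : beta_bundle :=
  let u := repr e in beta_bundle_pt (tagged u).1 (beta_unit R (tagged u).2).

Lemma bundle_embedE (i : I) (x : set_type (chart c i)) (h : G) :
  bundle_embed (group_bundle_pt x h) = beta_bundle_pt x (beta_unit R h).
Proof.
rewrite /bundle_embed.
case: (repr _) (reprK (group_bundle_pt x h)) => j [y k] /= /bundle_ptP [yx kh].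
apply/bundle_ptP; split=> //=.
by rewrite beta_ract_unit kh.
Qed.

End Embedding.

(* An isomorphism of [E] with the principal bundle defined by [c]; the action
   of [G] by deck transformations is the left multiplication on the fibre. *)
Definition principal_bundle_iso (E M : topologicalType) (G : groupType)
    (I : finType) (c : cocycle G M I) (p : E -> M) (act : G -> E -> E)
    (Phi : E -> group_bundle c) : Prop :=
  homeomorphism Phi /\
  forall (y : E) (i : I) (x : set_type (chart c i)) (h : G),
    Phi y = group_bundle_pt x h ->
    p y = \val x /\ forall g, Phi (act g y) = group_bundle_pt x (g * h)%g.

(* Main.v *)
Require Import Defs.
From mathcomp Require Import all_boot all_order all_algebra.
From mathcomp Require Import generic_quotient monoid.
From mathcomp Require Import all_classical all_reals all_analysis.
From mathcomp Require Import complex.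
From mathcomp Require Import ring.

Set Implicit Arguments.
Unset Strict Implicit.
Unset Printing Implicit Defensive.

Import Order.TTheory GRing.Theory Num.Theory.
Import numFieldNormedType.Exports.

Local Open Scope classical_set_scope.
Local Open Scope ring_scope.

(** Over a chart [U i] the covering is the product of [U i] and [G], and the
    action of [h] carries the sheet of [1] isometrically onto the sheet of [h].
    Hence the distance of [(x, h)] and [(y, h)] does not depend on [h]
    ([sheet_pt_dist]), and uniform continuity of [f] makes [x |-> f (x, .)]
    continuous from [U i] to bounded functions on [G] with the supremum norm.
    As a point [xi] of the Stone-Cech compactification is a contractive
    character ([beta_dist]), the formula [(x, xi) |-> xi (f (x, .))] is jointly
    continuous; it is compatible with the gluing because [xi g] is [xi] composed
    with the right translation by [g]. This is the extension of [f]
    ([unif_continuous_extends]), and it is unique since the points of [G] are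
    dense in the fibre.

    Conversely, let [F] be continuous on the bundle. Its fibre is compact, so
    [F (x, xi)] varies little with [x], uniformly in [xi] ([fibrewise_near]).
    Two points of the covering at a small distance lie on the same sheet, with
    close projections: translate them by the deck group near a fixed point of
    the sheet of [1], which has a neighbourhood inside that sheet
    ([sheet_nbhs]). The radius depends on the point of the base only, and
    compactness of the base makes it uniform ([continuous_restricts]).

    The bundle is compact, its continuous functions separate its points
    ([beta_bundle_separated]), and the covering is dense in it. Then every
    character of the algebra of restrictions is the evaluation at one point of
    the bundle ([homeomorphic_maximal_ideal_space]).

    Both the Stone-Cech compactification and the maximal ideal space are handled
    through [character_limit]: a character of an algebra of functions on [X]
    that is closed under conjugation and under inverses of functions bounded
    away from zero is the limit, along a filter on [X], of the evaluations at
    points of [X]. Contractivity of characters and density of [X] follow. *)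

(** * Complex limits and the Gelfand topology *)

Lemma complex_hausdorff (R : realType) : hausdorff_space R[i]^o.
Proof. exact: norm_hausdorff. Qed.

Lemma split_complex (R : realType) (e : R) :
  ((e%:C)%C : R[i]) = ((e / 2)%:C)%C + ((e / 2)%:C)%C.
Proof. by rewrite -rmorphD -splitr. Qed.

(** Positive elements of [R[i]] are exactly the positive reals, so that radii
    can be taken in the ordered field [R]. *)
Lemma cvgC_ltP (R : realType) (T : Type) (F : set_system T) (FF : Filter F)
    (f : T -> R[i]^o) (l : R[i]^o) :
  f @ F --> l <->
  forall e : R, 0 < e -> \forall x \near F, `|l - f x| < (e%:C)%C.
Proof.
split=> [/cvgrPdist_lt fl e e0|fl]; first by apply: fl; rewrite ltcR.
apply/cvgrPdist_lt => e e0.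
have eE : ((complex.Re e)%:C)%C = e by rewrite RRe_real ?gtr0_real.
by rewrite -eE; apply: fl; rewrite -ltcR eE.
Qed.

Lemma cvgC_mul (R : realType) (T : Type) (F : set_system T) (FF : Filter F)
    (f g : T -> R[i]^o) (a b : R[i]^o) :
  f @ F --> a -> g @ F --> b ->
  (fun x => (f x : R[i]) * g x : R[i]^o) @ F --> ((a : R[i]) * b : R[i]^o).
Proof. exact: cvgM. Qed.

Lemma initial_cvg (S : choiceType) (T : topologicalType) (f : S -> T)
    (F : set_system S) (FF : Filter F) (s : S) :
  f @ F --> f s -> F --> (s : initial_topology f).
Proof.
move=> Ffs A /= [_ [[B Bop <-] Bfs sBfA]].
apply: (filterS sBfA); apply: Ffs.
by apply: open_nbhs_nbhs.
Qed.

Lemma maximal_ideal_space_cvgP (R : realType) (X : Type)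
    (A : set (X -> R[i]^o)) (T : Type) (F : set_system T) (FF : Filter F)
    (f : T -> maximal_ideal_space A) (phi : maximal_ideal_space A) :
  f @ F --> phi <->
  forall a : A, (fun t => \val (f t) a : R[i]^o) @ F --> (\val phi a : R[i]^o).
Proof.
split=> [fphi a|fphi].
  have idc : continuous (@id (maximal_ideal_space A)).
    by move=> x; exact: cvg_id.
  have := (maximal_ideal_space_continuousP _).1 idc a phi.
  exact: cvg_comp.
apply: initial_cvg.
apply/cvg_sup => a.
apply: (@initial_cvg {ptws A -> R[i]^o} R[i]^o (fun g => g a)).
exact: fphi.
Qed.

Lemma maximal_ideal_space_hausdorff (R : realType) (X : Type)
    (A : set (X -> R[i]^o)) : hausdorff_space (maximal_ideal_space A).
Proof.
move=> phi psi; rewrite cluster_cvgE => -[F PF [Fpsi Fphi]].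
apply: val_inj; apply: funext => a.
have idc : continuous (@id (maximal_ideal_space A)).
  by move=> x; exact: cvg_id.
have ca := (maximal_ideal_space_continuousP _).1 idc a.
apply: (@cvg_unique _ (@complex_hausdorff R)
  ((fun t : maximal_ideal_space A => \val t a : R[i]^o) @ F)).
- by apply: cvg_trans (ca phi); exact: cvg_app.
- by apply: cvg_trans (ca psi); exact: cvg_app.
Qed.

(** * Characters as limits of evaluations *)

Definition conj_closed (R : realType) (X : Type) (A : set (X -> R[i]^o)) :=
  forall f, A f -> A (fun x => (f x : R[i])^*)%C.

Definition inverse_closed (R : realType) (X : Type) (A : set (X -> R[i]^o)) :=
  forall f (e : R), A f -> 0 < e -> (forall x, (e%:C)%C <= `|f x|) ->
    A (fun x => (f x : R[i])^-1).

Section CharacterLimit.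
Variables (R : realType) (X : Type) (A : set (X -> R[i]^o)).
Hypotheses (Aalg : subalgebra A) (Aconj : conj_closed A).
Hypothesis Ainv : inverse_closed A.

Lemma character_cst (phi : maximal_ideal_space A) (k : R[i]) (u : A) :
  (forall x, \val u x = k) -> \val phi u = k.
Proof.
case: Aalg => A1 _ _ _.
case: phi => phi /= /set_mem [_ pZ pM [f fn0]] uk.
pose one : A := in_set_type A1.
have p1 : phi one = 1.
  apply: (mulIf fn0); rewrite mul1r; symmetry; apply: pM => x /=.
  by rewrite mul1r.
by rewrite (pZ k one u) ?p1 ?mulr1// => x /=; rewrite uk mulr1.
Qed.

(** The sets on which some nonnegative element of the kernel of [phi] is small.
    Nonnegativity makes it a filter: where [b + d] is below [e], so are [b] and
    [d]. *)
Definition character_filter (phi : maximal_ideal_space A) : set_system X :=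
  [set S | exists b : A, [/\ forall x, 0 <= \val b x :> R[i], \val phi b = 0 &
    exists2 e : R, 0 < e & forall x, \val b x < (e%:C)%C :> R[i] -> S x]].

(** If [b >= 0] is bounded below by [e > 0], then [b] is invertible in [A],
    hence is not in the kernel of a character. *)
Lemma character_filter_proper phi : ProperFilter (character_filter phi).
Proof.
case: (Aalg) => A1 AD AZ AM; have pcst := @character_cst phi.
case: phi pcst => phi phiP /= pcst.
have [pD pZ pM _] := set_mem phiP.
apply: Build_ProperFilter_ex.
  move=> S [/= b [b0 pb [e e0 bS]]]; apply: contrapT => /forallNP nS.
  have be x : (e%:C)%C <= \val b x :> R[i].
    have bR : (\val b x : R[i]) \is Num.real by apply: ger0_real; exact: b0.
    have eR : (e%:C)%C \is Num.real by apply: ger0_real; rewrite lecR ltW.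
    rewrite real_leNgt//.
    by apply/negP => bx; exact: (nS x (bS x bx)).
  have Ab : A (\val b) by exact: set_mem (valP b).
  have bi : A (fun x => (\val b x : R[i])^-1).
    by apply: (Ainv Ab e0) => y; rewrite (ger0_norm (b0 y)); exact: be.
  have bb x : \val (in_set_type A1) x =
      (\val b x : R[i]) * \val (in_set_type bi) x.
    by rewrite /= divff// gt_eqF// (lt_le_trans _ (be x))// ltcR.
  have /eqP := pM _ _ _ bb.
  by rewrite pb mul0r (pcst 1 (in_set_type A1) (fun=> erefl)) oner_eq0.
split.
- have A0 : A (fun=> 0 * 1 : R[i]^o) by exact: AZ.
  exists (in_set_type A0); split => /=; last by exists 1.
    by move=> x; rewrite mul0r.
  by apply: pcst => x /=; rewrite mul0r.
- move=> S T [/= b [b0 pb [e e0 bS]]] [/= d [d0 pd [e' e'0 dT]]].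
  have Abd : A (fun x => \val b x + \val d x).
    by apply: AD; exact: set_mem (valP _).
  exists (in_set_type Abd); split => /=.
  + by move=> x; rewrite addr_ge0.
  + by rewrite (pD b d)// pb pd addr0.
  + exists (Num.min e e'); first by rewrite lt_min e0.
    move=> x bdx; split.
    * apply: bS; apply: (@le_lt_trans _ _ (\val b x + \val d x)).
        by rewrite lerDl; exact: d0.
      by apply: (lt_le_trans bdx); rewrite lecR ge_min lexx.
    * apply: dT; apply: (@le_lt_trans _ _ (\val b x + \val d x)).
        by rewrite lerDr; exact: b0.
      by apply: (lt_le_trans bdx); rewrite lecR ge_min lexx orbT.
- move=> S T ST [/= b [b0 pb [e e0 bS]]]; exists b; split => //.
  by exists e => // x /bS /ST.
Qed.

(** The function [|a - phi a|^2] is a nonnegative element of the kernel. *)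
Lemma character_limit (phi : maximal_ideal_space A) (a : A) :
  \val a @ character_filter phi --> (\val phi a : R[i]^o).
Proof.
case: (Aalg) => A1 AD AZ AM.
have FF := character_filter_proper phi.
apply/cvgC_ltP => e e0.
pose k : R[i] := \val phi a.
have Aa : A (\val a) by exact: set_mem (valP a).
have Ak : A (fun=> - k * 1) by exact: AZ.
have Au : A (fun x => \val a x + - k * 1) by exact: AD.
have Aub := Aconj Au.
have Ab := AM _ _ Au Aub.
exists (in_set_type Ab); split => /=.
- by move=> x; rewrite -normCK exprn_ge0.
- have pAk : \val phi (in_set_type Ak) = - k.
    by apply: character_cst => x /=; rewrite mulr1.
  have [pD _ pM _] := set_mem (valP phi).
  rewrite (pM (in_set_type Au) (in_set_type Aub))//.
  by rewrite (pD a (in_set_type Ak))// [X in _ + X]pAk addrN mul0r.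
- exists (e ^+ 2); first by rewrite exprn_gt0.
  move=> x; rewrite -normCK rmorphXn/= mulr1 distrC.
  by rewrite ltr_pXn2r// nnegrE// lecR ltW.
Qed.

(** Automatic continuity: [phi a - phi b] is a limit of values of [a - b]. *)
Lemma character_dist (phi : maximal_ideal_space A) (a b : A) (e : R) :
  (forall x, `|\val a x - \val b x| <= (e%:C)%C) ->
  `|\val phi a - \val phi b| <= (e%:C)%C.
Proof.
move=> abe; apply/ler_addgt0Pr => d d0.
have FF := character_filter_proper phi.
have dE : ((complex.Re d)%:C)%C = d by rewrite RRe_real ?gtr0_real.
have d2 : 0 < complex.Re d / 2 by rewrite divr_gt0// -ltcR dE.
have /cvgC_ltP/(_ _ d2) pa := @character_limit phi a.
have /cvgC_ltP/(_ _ d2) pb := @character_limit phi b.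
have [x [ax bx]] := filter_ex (filterI pa pb).
have -> : (\val phi a : R[i]) - \val phi b =
    (\val phi a - \val a x) + (\val a x - \val b x) -
    (\val phi b - \val b x).
  by ring.
apply: (le_trans (ler_normB _ _)).
apply: (le_trans (lerD (ler_normD _ _) (lexx _))).
rewrite -dE [complex.Re d]splitr rmorphD/= addrA.
apply: lerD; last exact: ltW.
by rewrite [leRHS]addrC; apply: lerD; [exact: ltW|exact: abe].
Qed.

End CharacterLimit.

(** * Compactness of the maximal ideal space and of beta G *)

Lemma ultrafilter_compact_cvg (T : Type) (Y : topologicalType)
    (U : set_system T) (f : T -> Y) (K : set Y) :
  UltraFilter U -> compact K -> U (f @^-1` K) -> exists y : Y, f @ U --> y.
Proof.
move=> UU cK UK; have [y [_ Uy]] := cK (f @ U) _ UK.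
exists y => V Vy; have [//|UV] := in_ultra_setVsetC (f @^-1` V) UU.
by have [z []] := Uy (~` V) V UV Vy.
Qed.

Lemma complex_box_compact (R : realType) (K : R) :
  compact [set z : R[i]^o |
    - K <= complex.Re z <= K /\ - K <= complex.Im z <= K].
Proof.
pose h (u : R * R) : R[i]^o := (u.1 +i* u.2)%C.
have hc : continuous h.
  move=> u; apply/cvgC_ltP => e e0.
  have e2 : 0 < e / 2 by rewrite divr_gt0.
  have /cvgrPdist_lt/(_ _ e2) u1 : (fun v : R * R => v.1) @ u --> u.1.
    exact: cvg_fst.
  have /cvgrPdist_lt/(_ _ e2) u2 : (fun v : R * R => v.2) @ u --> u.2.
    exact: cvg_snd.
  near=> v.
  have -> : (h u : R[i]) - h v =
      ((u.1 - v.1)%:C)%C + 'i%C * ((u.2 - v.2)%:C)%C.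
    by apply/eqP; rewrite eq_complex /=; apply/andP; split; apply/eqP; ring.
  apply: (le_lt_trans (ler_normD _ _)).
  rewrite normrM [`|'i%C|](_ : _ = 1); last first.
    by rewrite normc_def /= expr0n expr1n add0r sqrtr1.
  rewrite mul1r !normc_def /= expr0n !addr0 !sqrtr_sqr -rmorphD/= ltcR.
  rewrite [e]splitr; apply: ltrD; [near: v; exact: u1|near: v; exact: u2].
have := @continuous_compact _ _ h _ (continuous_subspaceT hc)
  (compact_setX (@segment_compact R (- K) K) (@segment_compact R (- K) K)).
congr compact; apply/seteqP.
split => [_ [[a b] /= [aK bK] <-]|[a b] /= [aK bK]].
  by move: aK bK; rewrite /= !in_itv/=.
by exists (a, b) => //; split; rewrite /= in_itv.
Unshelve. all: by end_near. Qed.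

Lemma norm_le_complex_box (R : realType) (K : R) (z : R[i]) :
  `|z| <= (K%:C)%C ->
  - K <= complex.Re z <= K /\ - K <= complex.Im z <= K.
Proof.
move=> zK.
have K0 : 0 <= K by rewrite -lecR; exact: le_trans (normr_ge0 z) zK.
move: zK; rewrite normc_def lecR -{1}(ger0_norm K0) -sqrtr_sqr.
rewrite ler_sqrt ?sqr_ge0// => zK.
split; rewrite -ler_norml -(ger0_norm K0) -ler_sqr ?nnegrE//
  !real_normK ?num_real//.
  by apply: le_trans zK; rewrite lerDl sqr_ge0.
by apply: le_trans zK; rewrite lerDr sqr_ge0.
Qed.

Section Compactness.
Variables (R : realType) (X : Type) (A : set (X -> R[i]^o)).
Hypotheses (Aalg : subalgebra A) (Aconj : conj_closed A).
Hypotheses (Ainv : inverse_closed A) (Abnd : A `<=` @bounded_function R X).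

Lemma character_norm (phi : maximal_ideal_space A) (a : A) (K : R) :
  (forall x, `|\val a x| <= (K%:C)%C) -> `|\val phi a| <= (K%:C)%C.
Proof.
move=> aK; case: (Aalg) => A1 AD AZ AM.
have A0 : A (fun=> 0 * 1 : R[i]^o) by exact: AZ.
have p0 : \val phi (in_set_type A0) = 0.
  by apply: (character_cst Aalg) => x /=; rewrite mul0r.
have := @character_dist _ _ _ Aalg Aconj Ainv phi a (in_set_type A0) K.
rewrite p0 subr0; apply=> x /=.
by rewrite mul0r subr0; exact: aK.
Qed.

(** An ultrafilter of characters converges pointwise, because the values at a
    given function are bounded, and the limit is again a character. *)
Lemma maximal_ideal_space_compact : compact [set: maximal_ideal_space A].
Proof.
rewrite compact_ultra => U UU _.
have UP : ProperFilter U by exact: ultra_proper.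
have /choice[l lP] (a : A) :
    exists l : R[i]^o,
      (fun phi : maximal_ideal_space A => \val phi a : R[i]^o) @ U --> l.
  have [K aK] := Abnd (set_mem (valP a)).
  apply: (@ultrafilter_compact_cvg _ R[i]^o U
    (fun phi : maximal_ideal_space A => \val phi a : R[i]^o) _ UU
    (@complex_box_compact R K)).
  apply: filterE => phi; apply: norm_le_complex_box.
  exact: character_norm.
have luniq a (f : maximal_ideal_space A -> R[i]^o) k : f @ U --> k ->
    (forall phi, \val phi a = f phi) -> l a = k.
  move=> fk af; apply: (cvg_unique (@complex_hausdorff R) (lP a)).
  have aE : (fun phi : maximal_ideal_space A => \val phi a : R[i]^o) = f.
    exact: funext.
  by rewrite -aE in fk.
have lchar : @character R X A l.
  split.
  - move=> f g h fgh; apply: (luniq _ _ _ (cvgD (lP f) (lP g))) => phi.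
    by have [pD _ _ _] := set_mem (valP phi); exact: pD.
  - move=> c f h fh.
    have cc : (fun=> c : R[i]^o) @ U --> (c : R[i]^o) by apply: cvg_cst.
    apply: (luniq _ _ _ (cvgC_mul _ cc (lP f))) => phi.
    by have [_ pZ _ _] := set_mem (valP phi); exact: pZ.
  - move=> f g h fgh.
    apply: (luniq _ _ _ (cvgC_mul _ (lP f) (lP g))) => phi.
    by have [_ _ pM _] := set_mem (valP phi); exact: pM.
  - case: (Aalg) => A1 _ _ _; exists (in_set_type A1).
    rewrite (luniq _ (fun=> 1) 1) ?oner_neq0//; first exact: cvg_cst.
    by move=> phi; exact: (character_cst Aalg).
exists (in_set_type lchar); split => //.
by apply/maximal_ideal_space_cvgP => a; exact: lP.
Qed.

End Compactness.

Lemma bounded_function_conj (R : realType) (X : Type) :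
  conj_closed (@bounded_function R X).
Proof. by move=> f [K fK]; exists K => x; rewrite norm_conjC. Qed.

Lemma bounded_function_inverse (R : realType) (X : Type) :
  inverse_closed (@bounded_function R X).
Proof.
move=> f e _ e0 ef; exists e^-1 => x.
have e0' : 0 < (e%:C)%C :> R[i] by rewrite ltcR.
rewrite normfV fmorphV lef_pV2 ?posrE//.
exact: lt_le_trans (ef x).
Qed.

Section BetaUnit.
Variables (R : realType) (G : groupType).

Lemma beta_compact : compact [set: beta R G].
Proof.
apply: maximal_ideal_space_compact => //.
- exact: bounded_function_subalgebra.
- exact: bounded_function_conj.
- exact: bounded_function_inverse.
Qed.

(** Density of [G], stated with filters as they are what limits of functions on
    the bundle are taken along. *)
Lemma beta_unit_limit (xi : beta R G) :
  exists2 F : set_system G, ProperFilter F & (@beta_unit R G) @ F --> xi.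
Proof.
have Aalg := @bounded_function_subalgebra R G.
have Aconj := @bounded_function_conj R G.
have Ainv := @bounded_function_inverse R G.
exists (character_filter xi); first exact: character_filter_proper.
have FF := character_filter_proper Aalg Ainv xi.
by apply/maximal_ideal_space_cvgP => a; exact: character_limit.
Qed.

Lemma beta_dist (xi : beta R G) (a b : @bounded_function R G) (e : R) :
  (forall h, `|\val a h - \val b h| <= (e%:C)%C) ->
  `|\val xi a - \val xi b| <= (e%:C)%C.
Proof.
apply: character_dist.
- exact: bounded_function_subalgebra.
- exact: bounded_function_conj.
- exact: bounded_function_inverse.
Qed.

Lemma beta_norm (xi : beta R G) (a : @bounded_function R G) (K : R) :
  (forall h, `|\val a h| <= (K%:C)%C) -> `|\val xi a| <= (K%:C)%C.
Proof.
apply: character_norm.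
- exact: bounded_function_subalgebra.
- exact: bounded_function_conj.
- exact: bounded_function_inverse.
Qed.

End BetaUnit.

(** * The maximal ideal space of an algebra of restrictions *)

Lemma compact_hausdorff_homeomorphism (X Y : topologicalType) (f : X -> Y) :
  compact [set: X] -> hausdorff_space Y -> continuous f -> bijective f ->
  homeomorphism f.
Proof.
move=> Xc Yh fc [g fK gK]; split=> //; exists g; split=> //.
apply/continuous_closedP => C Cc.
have -> : g @^-1` C = f @` C.
  apply/seteqP; split=> [y Cy|_ [x Cx <-]]; first by exists (g y); rewrite ?gK.
  by rewrite /preimage/= fK.
apply: compact_closed => //; apply: continuous_compact.
  exact: continuous_subspaceT.
exact: (subclosed_compact Cc Xc).
Qed.

Section ExtensionAlgebra.
Variables (R : realType) (X : Type) (E : topologicalType) (j : X -> E).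
Hypothesis E_compact : compact [set: E].
Hypothesis E_separated : forall e1 e2 : E,
  (forall F : E -> R[i]^o, continuous F -> F e1 = F e2) -> e1 = e2.
Hypothesis j_dense : forall e : E,
  exists2 K : set_system X, ProperFilter K & j @ K --> e.

Lemma dense_continuous_eq (F1 F2 : E -> R[i]^o) :
  continuous F1 -> continuous F2 -> (forall x, F1 (j x) = F2 (j x)) -> F1 = F2.
Proof.
move=> F1c F2c F12; apply: funext => e.
have [K KF jK] := j_dense e.
apply: (@cvg_unique _ (@complex_hausdorff R) ((F1 \o j) @ K)).
  exact: cvg_comp jK (F1c e).
have -> : F1 \o j = F2 \o j by apply: funext => x; exact: F12.
exact: cvg_comp jK (F2c e).
Qed.

Variable A : set (X -> R[i]^o).
Hypothesis A_extends : forall f, A f ->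
  exists F : E -> R[i]^o, continuous F /\ forall x, F (j x) = f x.
Hypothesis A_restricts : forall F : E -> R[i]^o, continuous F -> A (F \o j).

Lemma extension_ex (a : A) :
  exists F : E -> R[i]^o, continuous F /\ forall x, F (j x) = \val a x.
Proof. by apply: A_extends; exact: set_mem (valP a). Qed.

Definition extension (a : A) : E -> R[i]^o := sval (cid (extension_ex a)).

Lemma extension_continuous (a : A) : continuous (extension a).
Proof. by rewrite /extension; case: cid => F []. Qed.

Lemma extensionE (a : A) x : extension a (j x) = \val a x.
Proof. by rewrite /extension; case: cid => F []. Qed.

Lemma extension_unique (a : A) (F : E -> R[i]^o) :
  continuous F -> (forall x, F (j x) = \val a x) -> extension a = F.
Proof.
move=> Fc FE; apply: dense_continuous_eq => //.
  exact: extension_continuous.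
by move=> x; rewrite extensionE FE.
Qed.

Lemma restriction_mem (f : X -> R[i]^o) (F : E -> R[i]^o) :
  continuous F -> (forall x, F (j x) = f x) -> A f.
Proof.
by move=> /A_restricts AF Ff; rewrite (_ : f = F \o j)//; apply: funext => x /=.
Qed.

Lemma restriction_subalgebra : subalgebra A.
Proof.
split.
- by apply: (@restriction_mem _ (fun=> 1)) => // e; exact: cvg_cst.
- move=> f g /A_extends[F [Fc Ff]] /A_extends[H [Hc Hg]].
  apply: (@restriction_mem _ (fun e => F e + H e)) => [e|x].
    exact: cvgD (Fc e) (Hc e).
  by rewrite Ff Hg.
- move=> k f /A_extends[F [Fc Ff]].
  apply: (@restriction_mem _ (fun e => k * F e)) => [e|x]; last by rewrite Ff.
  by apply: cvgC_mul (Fc e); exact: cvg_cst.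
- move=> f g /A_extends[F [Fc Ff]] /A_extends[H [Hc Hg]].
  apply: (@restriction_mem _ (fun e => (F e : R[i]) * H e)) => [e|x].
    exact: cvgC_mul (Fc e) (Hc e).
  by rewrite Ff Hg.
Qed.

Lemma restriction_conj : conj_closed A.
Proof.
move=> f /A_extends[F [Fc Ff]].
apply: (@restriction_mem _ (fun e => (F e : R[i])^*)%C) => [e|x]; last first.
  by rewrite Ff.
apply/cvgC_ltP => d d0; have /cvgC_ltP/(_ _ d0) := Fc e.
by apply: filterS => e'; rewrite -rmorphB norm_conjC.
Qed.

(** A lower bound on the modulus passes from the dense subset to the whole
    space, so that the extension has no zero. *)
Lemma restriction_inverse : inverse_closed A.
Proof.
move=> f d /A_extends[F [Fc Ff]] d0 df.
apply: (@restriction_mem _ (fun e => (F e : R[i])^-1)) => [e|x]; last first.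
  by rewrite Ff.
apply: (@cvgV R[i] E (nbhs e) _ F (F e)); last exact: Fc.
apply/eqP => Fe0; have [K KF jK] := j_dense e.
have /cvgC_ltP/(_ _ d0) := cvg_comp _ _ jK (Fc e).
move=> /filter_ex[x /=]; rewrite Fe0 sub0r normrN Ff => fx.
by have := lt_le_trans fx (df x); rewrite ltxx.
Qed.

Lemma evaluation_subproof (e : E) : @character R X A (fun a => extension a e).
Proof.
have extc := extension_continuous.
split.
- move=> f g h fgh.
  rewrite (@extension_unique h (fun e => extension f e + extension g e))//.
    by move=> e'; exact: cvgD (extc f e') (extc g e').
  by move=> x; rewrite !extensionE fgh.
- move=> k f h fh; rewrite (@extension_unique h (fun e => k * extension f e))//.
    by move=> e'; apply: cvgC_mul (extc f e'); exact: cvg_cst.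
  by move=> x; rewrite extensionE fh.
- move=> f g h fgh.
  rewrite (@extension_unique h
    (fun e => (extension f e : R[i]) * extension g e))//.
    by move=> e'; exact: cvgC_mul (extc f e') (extc g e').
  by move=> x; rewrite !extensionE fgh.
- have [A1 _ _ _] := restriction_subalgebra.
  exists (in_set_type A1); rewrite (@extension_unique _ (fun=> 1)) ?oner_eq0//.
  by move=> e'; exact: cvg_cst.
Qed.

Definition evaluation (e : E) : maximal_ideal_space A :=
  in_set_type (evaluation_subproof e).

Lemma evaluation_continuous : continuous evaluation.
Proof.
by apply/maximal_ideal_space_continuousP => a; exact: extension_continuous.
Qed.

Lemma evaluation_injective : injective evaluation.
Proof.
move=> e1 e2 e12; apply: E_separated => F Fc.
pose a : A := in_set_type (A_restricts Fc).
have <- : extension a = F by exact: extension_unique.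
exact: (congr1 (fun phi => \val phi a) e12).
Qed.

(** The filter on [X] along which evaluations tend to [phi] has a cluster point
    in the compact space [E]; by continuity of the extensions, evaluation there
    is [phi]. *)
Lemma evaluation_surjective phi : exists e, evaluation e = phi.
Proof.
have FF :=
  character_filter_proper restriction_subalgebra restriction_inverse phi.
have [e [_ je]] := E_compact (fmap_proper_filter j FF) filterT.
exists e; apply: val_inj; apply: funext => a /=.
move: je; rewrite cluster_cvgE => -[H HF [He jH]].
apply: (@cvg_unique _ (@complex_hausdorff R) (extension a @ H)).
  apply: cvg_trans (@extension_continuous a e); exact: cvg_app.
have := @character_limit _ _ _ restriction_subalgebra restriction_conj
  restriction_inverse phi a.
apply: cvg_trans => B.
have -> : \val a = extension a \o j.
  by apply: funext => x /=; rewrite extensionE.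
exact: jH.
Qed.

Lemma homeomorphic_maximal_ideal_space :
  homeomorphic E (maximal_ideal_space A).
Proof.
exists evaluation; apply: compact_hausdorff_homeomorphism => //.
- exact: maximal_ideal_space_hausdorff.
- exact: evaluation_continuous.
- have /choice[g gP] := evaluation_surjective.
  by exists g => // e; apply: evaluation_injective.
Qed.

End ExtensionAlgebra.

(** * Topology of a bundle with a locally constant cocycle *)

Lemma subtype_nbhs (M : topologicalType) (U : set M) (x : U) (Q : U -> Prop) :
  (\forall y \near x, Q y) ->
  \forall z \near \val x, forall y : U, \val y = z -> Q y.
Proof.
move=> [_ [[B Bop <-] Bx BQ]].
have : nbhs (\val x) B by exact: open_nbhs_nbhs.
by apply: filterS => z Bz y yz; apply: BQ; move: Bz; rewrite -yz.
Qed.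

Lemma subtype_val_continuous (M : topologicalType) (U : set M) :
  continuous (\val : U -> M).
Proof. exact: initial_continuous. Qed.

Section Bundle.
Variables (G : groupType) (M : topologicalType) (I : finType).
Variables (c : cocycle G M I) (F : topologicalType) (a : right_action G F).

Local Notation U i := (set_type (chart c i)).

Lemma chart_near (i : I) (x : M) :
  chart c i x -> \forall y \near x, chart c i y.
Proof. by move=> ix; exact: (open_nbhs_nbhs (conj (chart_open c i) ix)). Qed.

Lemma chart_ex (x : M) : exists i (y : U i), \val y = x.
Proof.
have [i _ ix] : (\bigcup_i chart c i) x by rewrite chart_setT.
by exists i, (in_set_type ix).
Qed.

Lemma bundle_pt_continuous (i : I) :
  continuous (fun u : U i * F => bundle_pt a u.1 u.2).
Proof.
move=> u; pose X i := (U i * F)%type.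
have ec : {for u, continuous (existT X i)} by exact: existT_continuous.
have pc :
    {for existT X i u, continuous (\pi_(bundle c a)%qT : _ -> bundle c a)}.
  exact: pi_continuous.
rewrite (_ : (fun u => _) =
  (\pi_(bundle c a)%qT : _ -> bundle c a) \o existT X i).
  exact: continuous_comp ec pc.
by apply: funext => -[].
Qed.

Lemma bundle_continuous (Y : topologicalType) (f : bundle c a -> Y) :
  (forall i, continuous (fun u : U i * F => f (bundle_pt a u.1 u.2))) ->
  continuous f.
Proof.
move=> fc; apply/quotient_continuous.
move=> -[i [x xi]] B /(fc i (x, xi)) fB; change (nbhs (x, xi)
  [set u : U i * F | B (f (\pi_(bundle c a)%qT (existT _ i u)))]).
have FF : Filter (nbhs (x, xi)) by exact: nbhs_filter.
by apply: (@filterS _ _ FF _ _ _ fB) => -[].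
Qed.

(** Computed on the representative that the quotient chooses; [bundle_liftE]
    makes the choice irrelevant for a compatible family. *)
Definition bundle_lift (Y : Type) (phi : forall i, U i -> F -> Y)
    (e : bundle c a) : Y :=
  phi (tag (repr e)) (tagged (repr e)).1 (tagged (repr e)).2.

Definition bundle_compatible (Y : Type) (phi : forall i, U i -> F -> Y) :=
  forall i j (x : U i) (y : U j) xi, \val x = \val y ->
    phi j y (a xi (cocycle_map c i j (\val x))) = phi i x xi.

Lemma bundle_liftE (Y : Type) (phi : forall i, U i -> F -> Y) :
  bundle_compatible phi ->
  forall i (x : U i) xi, bundle_lift phi (bundle_pt a x xi) = phi i x xi.
Proof.
move=> phiC i x xi; rewrite /bundle_lift.
case: (repr _) (reprK (bundle_pt a x xi)) => j [y eta] /= /bundle_ptP[yx ->].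
by symmetry; apply: phiC.
Qed.

Lemma bundle_pt_over (i j : I) (x : U i) (y : U j) (eta : F) :
  \val y = \val x ->
  bundle_pt a y eta = bundle_pt a x (a eta (cocycle_map c j i (\val y))).
Proof. by move=> yx; apply/bundle_ptP. Qed.

(** The charts of the bundle are open maps: the saturation of an open subset of
    [U i * F] is read in [U j * F] through the transition map, which is locally
    independent of the base point and continuous in the fibre. *)
Lemma bundle_pt_open (ac : forall g, continuous (a ^~ g)) (i : I) (x : U i)
    (xi : F) (P : bundle c a -> Prop) :
  (\forall u \near (x, xi), P (bundle_pt a u.1 u.2)) ->
  \forall e \near bundle_pt a x xi, P e.
Proof.
move=> xiP.
have : nbhs (x, xi) [set u | P (bundle_pt a u.1 u.2)] by exact: xiP.
rewrite nbhsE => -[] O [Oop Oxi] OP.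
pose W := [set bundle_pt a u.1 u.2 | u in O].
suff Wop : open W.
  apply: (@filterS _ _ _ W); first by move=> _ [u Ou <-]; exact: OP.
  by apply: open_nbhs_nbhs; split=> //; exists (x, xi).
rewrite /open /= /quotient_open openE => -[j [y eta]] [u Ou /bundle_ptP[uy uE]].
have [[/= N1 N2] [uN1 uN2] NO] : nbhs u O by exact: open_nbhs_nbhs.
have iy : chart c i (\val y) by rewrite -uy; exact: chart_val.
have jy : chart c j (\val y) by exact: chart_val.
have vy := @subtype_val_continuous _ _ y.
pose g := cocycle_map c j i (\val y).
have u2E : u.2 = a eta g.
  by rewrite uE -ractM uy cocycleP// cocycle_id// ract1.
have ny : \forall y' \near y, [/\ chart c i (\val y'),
    cocycle_map c j i (\val y') = g & forall z, \val z = \val y' -> N1 z].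
  have n1 := vy _ (chart_near iy).
  have n2 := vy _ (cocycle_locally_constant jy iy).
  have n3 := subtype_nbhs uN1; rewrite uy in n3.
  have {}n3 := vy _ n3.
  have FF : Filter (nbhs y) by exact: nbhs_filter.
  by apply: (@filterS3 _ _ FF _ _ _ _ _ n1 n2 n3) => y' *; split.
have neta : \forall eta' \near eta, N2 (a eta' g).
  by rewrite u2E in uN2; exact: (ac g eta _ uN2).
exists ([set y' | [/\ chart c i (\val y'),
    cocycle_map c j i (\val y') = g & forall z, \val z = \val y' -> N1 z]],
  [set eta' | N2 (a eta' g)]) => //.
move=> [y' eta'] [/= [iy' gE zN1] etaN2].
exists (in_set_type iy', a eta' g); first by apply: NO; split=> //; exact: zN1.
by rewrite -gE; symmetry; apply: bundle_pt_over.
Qed.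

(** Compactness is used as the passage from local to uniform validity of a
    property depending on a parameter: once along the fibre over each point of
    the base, then along the base. *)
Lemma bundle_compact : compact [set: M] -> compact [set: F] ->
  compact [set: bundle c a].
Proof.
move=> /compact_near_coveringP Mc /compact_near_coveringP Fc.
apply/compact_near_coveringP => T K P FK eP.
suff : \near K, [set: M] `<=` (fun x => forall i (y : U i) xi,
    \val y = x -> P K (bundle_pt a y xi)).
  apply: filterS => k kP e _; have [i [x [xi ->]]] := bundle_ptW e.
  exact: kP.
apply: Mc => x _; have [i [xu <-]] := chart_ex x.
have : \forall u \near filter_prod (nbhs xu) K, [set: F] `<=`
    (fun xi => P u.2 (bundle_pt a u.1 xi)).
  have FK' : Filter (filter_prod (nbhs xu) K).
    by apply: filter_prod_filter; exact: nbhs_filter.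
  apply: (Fc _ _ (fun u xi => P u.2 (bundle_pt a u.1 xi))) => xi _.
  have [[/= A B] [eA KB] AB] := eP (bundle_pt a xu xi) Logic.I.
  have [[/= A1 A2] [xuA1 xiA2] AA] := @bundle_pt_continuous i (xu, xi) _ eA.
  exists (A2, A1 `*` B); first by split => //; exists (A1, B).
  move=> [xi' [x' k]] [/= xi'A [x'A kB]]; apply: (AB (_, k)); split => //=.
  exact: (AA (x', xi')).
move=> [[/= A B] [xA KB] AB].
exists ([set z | forall y : U i, \val y = z -> A y] `&` chart c i, B).
  split=> //; apply: filterI; first exact: subtype_nbhs.
  by apply: chart_near; exact: chart_val.
move=> [z k] [/= [zA iz] kB] j y xi yz.
rewrite (@bundle_pt_over i j (in_set_type iz))//.
by apply: (AB (_, k)) => //; split => //; exact: zA.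
Qed.

End Bundle.

(** * Density of the covering and separation of points *)

Lemma compact_hausdorff_bump (R : realType) (M : topologicalType) (x : M)
    (C : set M) :
  hausdorff_space M -> compact [set: M] -> closed C -> ~ C x ->
  exists chi : M -> R, [/\ continuous chi, chi x = 1 &
    forall y, C y -> chi y = 0].
Proof.
move=> Mh Mc Cc nCx.
have x1 : closed [set x].
  exact: (accessible_closed_set1 (hausdorff_accessible Mh)).
have Cx0 : C `&` [set x] = set0.
  by rewrite -subset0 => y [Cy /= yx]; apply: nCx; rewrite -yx.
have Mn := compact_normal Mh Mc.
have /(@uniform_separatorP _ R)[f [fc _ f0 f1]] :=
  (@normal_separatorP R M).1 Mn _ _ Cc x1 Cx0.
exists f; split=> //.
  by apply: f1; exists x.
by move=> y Cy; apply: f0; exists y.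
Qed.

Section BetaBundle.
Variables (R : realType) (G : groupType) (M : topologicalType) (I : finType).
Variable c : cocycle G M I.

Local Notation U i := (set_type (chart c i)).
Local Notation linf := (@bounded_function R G).

Lemma bundle_embed_dense (e : beta_bundle R c) :
  exists2 K : set_system (group_bundle c), ProperFilter K &
    (@bundle_embed R G M I c) @ K --> e.
Proof.
have [i [x [xi ->]]] := bundle_ptW e.
have [K KF Kxi] := beta_unit_limit xi.
exists ((fun h => group_bundle_pt x h) @ K); first exact: fmap_proper_filter.
have cu : (fun h => (x, beta_unit R h) : U i * beta R G) @ K --> (x, xi).
  move=> B [[/= B1 B2] [xB xiB] BB].
  apply: (@filterS _ K _ _ _ _ (Kxi _ xiB)) => h hB; apply: BB; split => //=.
  exact: nbhs_singleton xB.
have uc := cvg_comp _ _ cu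
  (@bundle_pt_continuous _ _ _ c _ (beta_right_action R G) i (x, xi)).
move=> B /uc HB; apply: (@filterS _ K _ _ _ _ HB) => h /=.
by rewrite /preimage/= bundle_embedE.
Qed.

Section Bump.
Variables (i : I) (chi : M -> R) (a : linf).

(** The function [(x, xi) |-> chi x * xi a] of the chart [U i], read in the
    chart [U j]. Outside [U i], where the cocycle takes arbitrary values, the
    factor [chi y] is zero. *)
Definition bump_section (j : I) (y : U j) (zeta : beta R G) : R[i]^o :=
  (((chi (\val y))%:C)%C : R[i]) *
  \val (beta_ract zeta (cocycle_map c j i (\val y))) a.

Hypothesis chi_continuous : continuous chi.
Hypothesis chi0 : forall y, ~ chart c i y -> chi y = 0.

Lemma bump_section_compatible :
  bundle_compatible (beta_right_action R G) bump_section.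
Proof.
move=> j k x y xi xy; rewrite /bump_section -xy.
have [ix|nix] := pselect (chart c i (\val x)); last by rewrite chi0// !mul0r.
rewrite -[beta_ract (beta_right_action R G _ _) _]beta_ractM cocycleP//.
- exact: chart_val.
- by rewrite xy; exact: chart_val.
Qed.

(** Inside [U i] the transition element is locally constant. Outside, the value
    is zero and is approached because [xi a] is bounded while [chi] tends to
    zero; [chi] may thus have a support that is not contained in [U i]. *)
Lemma bump_section_continuous (j : I) :
  continuous (fun u : U j * beta R G => bump_section u.1 u.2).
Proof.
move=> [y0 zeta0].
have chic : (fun u : U j * beta R G => chi (\val u.1)) @ (y0, zeta0) -->
    chi (\val y0).
  have u1 : (fun u : U j * beta R G => u.1) @ (y0, zeta0) --> y0.
    exact: cvg_fst.
  have vu := cvg_comp _ _ u1 (@subtype_val_continuous _ _ y0).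
  exact: cvg_comp vu (@chi_continuous (\val y0)).
have chiC : (fun u : U j * beta R G => ((chi (\val u.1))%:C)%C : R[i]^o)
    @ (y0, zeta0) --> (((chi (\val y0))%:C)%C : R[i]^o).
  apply/cvgC_ltP => e e0; move/cvgrPdist_lt : chic => /(_ _ e0).
  apply: filterS => u; rewrite -rmorphB normc_def/= expr0n addr0 sqrtr_sqr.
  by rewrite ltcR.
have [iy|niy] := pselect (chart c i (\val y0)).
  pose g := cocycle_map c j i (\val y0).
  have gc : (fun u : U j * beta R G => \val (beta_ract u.2 g) a : R[i]^o)
      @ (y0, zeta0) --> (\val (beta_ract zeta0 g) a : R[i]^o).
    have uc : (fun u : U j * beta R G => beta_ract u.2 g) @ (y0, zeta0) -->
        beta_ract zeta0 g.
      have u2 : (fun u : U j * beta R G => u.2) @ (y0, zeta0) --> zeta0.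
        exact: cvg_snd.
      exact: cvg_comp u2 (@beta_ract_continuous _ _ g zeta0).
    exact: ((maximal_ideal_space_cvgP _ _ _).1 uc a).
  apply: cvg_trans (cvgC_mul _ chiC gc).
  apply: near_eq_cvg.
  have gE : \forall u \near (y0, zeta0),
      cocycle_map c j i (\val (u : U j * beta R G).1) = g.
    have jy : chart c j (\val y0) by exact: chart_val.
    have H := @subtype_val_continuous _ _ y0 _ (cocycle_locally_constant jy iy).
    exact: (@cvg_fst _ _ (nbhs y0) (nbhs zeta0) _ _ H).
  by apply: filterS gE => u uE; rewrite /bump_section uE.
have b0 : bump_section y0 zeta0 = 0 by rewrite /bump_section chi0// mul0r.
change ((fun u : U j * beta R G => bump_section u.1 u.2) @ (y0, zeta0) -->
  bump_section y0 zeta0).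
rewrite b0 /bump_section.
have [K K0 aK] := bounded_functionP (set_mem (valP a)).
apply/cvgC_ltP => e e0; have eK : 0 < e / K by rewrite divr_gt0.
move/cvgC_ltP : chiC => /(_ _ eK).
apply: filterS => u; rewrite chi0// sub0r normrN => chie.
rewrite sub0r normrN normrM.
have -> : ((e%:C)%C : R[i]) = ((e / K)%:C)%C * (K%:C)%C.
  by rewrite -rmorphM/= divfK ?gt_eqF.
apply: (@le_lt_trans _ _ (`|((chi (\val u.1))%:C)%C| * (K%:C)%C)).
  by apply: ler_wpM2l => //; exact: beta_norm.
by rewrite ltr_pM2r// ltcR.
Qed.

Definition bump : beta_bundle R c -> R[i]^o := bundle_lift bump_section.

Lemma bump_continuous : continuous bump.
Proof.
apply: bundle_continuous => j.
rewrite (_ : (fun u => _) = (fun u : U j * beta R G => bump_section u.1 u.2)).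
  exact: bump_section_continuous.
apply: funext => u; rewrite /bump bundle_liftE//.
exact: bump_section_compatible.
Qed.

Lemma bumpE (j : I) (y : U j) (zeta : beta R G) :
  bump (beta_bundle_pt y zeta) = bump_section y zeta.
Proof. by rewrite /bump bundle_liftE//; exact: bump_section_compatible. Qed.

End Bump.

Hypotheses (M_hausdorff : hausdorff_space M) (M_compact : compact [set: M]).

(** Points over distinct points of the base are separated by a function with
    [a = 1] whose [chi] vanishes at one of them; points of one fibre, being
    distinct characters, differ at some [a]. *)
Lemma beta_bundle_separated (e1 e2 : beta_bundle R c) :
  (forall F : beta_bundle R c -> R[i]^o, continuous F -> F e1 = F e2) ->
  e1 = e2.
Proof.
have [i [x [xi ->]]] := bundle_ptW e1.
have [j [y [eta ->]]] := bundle_ptW e2.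
rewrite -!/(beta_bundle_pt _ _) => F12.
have ix : chart c i (\val x) by exact: chart_val.
have cC : closed (~` chart c i) by apply: open_closedC; exact: chart_open.
have yx : \val y = \val x.
  apply: contrapT => yx.
  have yC : closed (~` chart c i `|` [set \val y]).
    apply: closedU => //.
    exact: (accessible_closed_set1 (hausdorff_accessible M_hausdorff)).
  have [] := @compact_hausdorff_bump R _ (\val x) _ M_hausdorff M_compact yC.
    by case=> // xy; exact: yx.
  move=> chi [chic chix chi0].
  have [A1 _ _ _] := @bounded_function_subalgebra R G.
  have chiU z : ~ chart c i z -> chi z = 0 by move=> ?; apply: chi0; left.
  have := F12 (bump i chi (in_set_type A1)) (bump_continuous chic chiU).
  rewrite !bumpE// /bump_section chix chi0; last by right.
  rewrite mul0r mul1r.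
  rewrite (@character_cst _ _ _ (@bounded_function_subalgebra R G) _ 1)//.
  by move/eqP; rewrite oner_eq0.
rewrite /beta_bundle_pt in F12 *.
rewrite (bundle_pt_over (beta_right_action R G) eta yx) in F12 *.
congr bundle_pt; apply: val_inj; apply: funext => a.
have [] := @compact_hausdorff_bump R _ (\val x) _ M_hausdorff M_compact cC.
  exact.
move=> chi [chic chix chi0].
have := F12 (bump i chi a) (bump_continuous chic chi0).
by rewrite !bumpE// /bump_section chix !mul1r cocycle_id// !beta_ract1.
Qed.

End BetaBundle.

(** * Uniformly continuous functions on the covering *)

Lemma compact_continuous_bounded (R : realType) (E : topologicalType)
    (F : E -> R[i]^o) :
  compact [set: E] -> continuous F -> bounded_function F.
Proof.
move=> /compact_near_coveringP Ec Fc.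
have /filter_ex[K KF] : \forall K \near +oo%R, [set: E] `<=`
    (fun e => `|F e| <= (K%:C)%C :> R[i]).
  apply: (Ec _ _ (fun K e => `|F e| <= (K%:C)%C :> R[i])) => e _.
  have /cvgC_ltP/(_ _ ltr01) Fe := Fc e.
  exists ([set e' | `|F e - F e'| < (1%:C)%C :> R[i]],
      [set K : R | complex.Re `|F e| + 1 <= K]).
    by split=> //=; apply: nbhs_pinfty_ge; exact: num_real.
  move=> [e' K] [/= ee' eK].
  have eE : ((complex.Re `|F e|)%:C)%C = `|F e| by rewrite RRe_real ?normr_real.
  have -> : F e' = F e - (F e - F e') by rewrite opprB addrC subrK.
  apply: (le_trans (ler_normB _ _)).
  apply: (@le_trans _ _ ((complex.Re `|F e| + 1)%:C)%C); last by rewrite lecR.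
  by rewrite rmorphD/= [X in X + _]eE; apply: lerD => //; exact: ltW.
by exists K => e; exact: KF.
Qed.

Lemma metric_unif_continuousP (R : realType) (X : metricType R)
    (f : X -> R[i]^o) :
  unif_continuous f <->
  forall e : R, 0 < e -> exists2 d : R, 0 < d &
    forall x y, mdist x y < d -> `|f x - f y| < (e%:C)%C.
Proof.
rewrite unif_continuousCP; split=> fe e e0; have {fe} := fe e e0.
  move=> fe.
  have : entourage [set u | `|f u.1 - f u.2| < (e%:C)%C :> R[i]] by exact: fe.
  rewrite -entourage_ballE => -[d /= d0 dP]; exists d => // x y xy.
  by apply: (dP (x, y)) => /=; rewrite ballEmdist.
move=> [d d0 dP].
suff : entourage [set u | `|f u.1 - f u.2| < (e%:C)%C :> R[i]] by [].
rewrite -entourage_ballE; exists d => //= -[x y] /=.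
by rewrite ballEmdist; exact: dP.
Qed.

Section MetricCovering.
Variables (R : realType) (M : topologicalType) (MG : metricType R).
Variables (G : groupType) (p : MG -> M) (act : G -> MG -> MG) (I : finType).
Variables (c : cocycle G M I) (Phi : MG -> group_bundle c).
Hypothesis d_invariant : forall g x y, mdist (act g x) (act g y) = mdist x y.
Hypothesis Phi_equivariant :
  forall (y : MG) (i : I) (x : set_type (chart c i)) (h : G),
    Phi y = group_bundle_pt x h ->
    p y = \val x /\ forall g, Phi (act g y) = group_bundle_pt x (g * h)%g.
Variable Psi : group_bundle c -> MG.
Hypotheses (Phi_continuous : continuous Phi) (Psi_continuous : continuous Psi).
Hypotheses (PhiK : cancel Phi Psi) (PsiK : cancel Psi Phi).

Local Notation U i := (set_type (chart c i)).
Local Notation linf := (@bounded_function R G).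

(** The point [(x, h)] of the covering in the trivialization over [U i]. *)
Definition sheet_pt (i : I) (x : U i) (h : G) : MG := Psi (group_bundle_pt x h).

Lemma sheet_pt_proj i (x : U i) h : p (sheet_pt x h) = \val x.
Proof. by have [] := Phi_equivariant (PsiK (group_bundle_pt x h)). Qed.

Lemma act_sheet_pt g i (x : U i) h :
  act g (sheet_pt x h) = sheet_pt x (g * h)%g.
Proof.
have [_ /(_ g) E] := Phi_equivariant (PsiK (group_bundle_pt x h)).
by rewrite -[LHS]PhiK E.
Qed.

(** Invariance of the metric: the action of [h] maps the sheet of [1] onto the
    sheet of [h]. *)
Lemma sheet_pt_dist i (x y : U i) h :
  mdist (sheet_pt x h) (sheet_pt y h) = mdist (sheet_pt x 1%g) (sheet_pt y 1%g).
Proof. by rewrite -[in LHS](mulg1 h) -!act_sheet_pt d_invariant. Qed.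

Lemma sheet_pt_continuous i h : continuous (fun x : U i => sheet_pt x h).
Proof.
move=> x; pose D : topologicalType := discrete_topology G.
have pc : (fun y : U i => (y, h : D)) @ x --> ((x, h) : U i * D).
  move=> B [[/= B1 B2] [xB hB] BB].
  apply: (@filterS _ (nbhs x) _ _ _ _ xB) => y yB; apply: BB; split => //=.
  exact: nbhs_singleton hB.
have bc := cvg_comp _ _ pc
  (@bundle_pt_continuous _ _ _ c _ (group_right_action G) i (x, h : D)).
exact: cvg_comp bc (@Psi_continuous (group_bundle_pt x h)).
Qed.

Lemma sheet_ptW (y : MG) i (x : U i) :
  p y = \val x -> exists h, y = sheet_pt x h.
Proof.
have [j [z [k yE]]] := bundle_ptW (Phi y).
have [pz _] := Phi_equivariant yE; rewrite pz => zx.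
exists (k * cocycle_map c j i (\val z))%g.
by rewrite -[LHS]PhiK yE; congr Psi; exact: bundle_pt_over.
Qed.

Lemma act_invK h : cancel (act h^-1%g) (act h).
Proof.
move=> y; have [i [x [k yE]]] := bundle_ptW (Phi y).
by rewrite -[y]PhiK yE !act_sheet_pt mulVKg.
Qed.

Lemma bundle_embed_sheet_pt i (x : U i) h :
  bundle_embed R (Phi (sheet_pt x h)) = beta_bundle_pt x (beta_unit R h).
Proof. by rewrite PsiK bundle_embedE. Qed.

(** The sheets over a chart are open, since the fibre is discrete. *)
Lemma sheet_nbhs i (x0 : U i) (Q : U i -> Prop) :
  (\forall x \near x0, Q x) ->
  \forall y \near sheet_pt x0 1%g, exists2 x, Q x & y = sheet_pt x 1%g.
Proof.
move=> Qx0; pose D : topologicalType := discrete_topology G.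
have xN : \forall u \near ((x0, 1%g) : U i * D),
    exists2 x, Q x &
      Psi (bundle_pt (group_right_action G) u.1 u.2) = sheet_pt x 1%g.
  exists ([set x | Q x], [set 1%g : D]) => /=.
    by split => //; exact: discrete_set1.
  by move=> [x h] [/= Qx ->]; exists x.
have ac (g : G) : continuous ((group_right_action G : D -> _) ^~ g).
  move=> h B hB; apply: (@filterS D (nbhs (h : D)) _ [set h : D]).
    by move=> _ ->; exact: nbhs_singleton hB.
  exact: discrete_set1.
have N := @bundle_pt_open _ _ _ c D (group_right_action G) ac _ _ _
  (fun e => exists2 x, Q x & Psi e = sheet_pt x 1%g) xN.
have Phix0 : Phi (sheet_pt x0 1%g) =
    bundle_pt (group_right_action G) x0 (1%g : D) by exact: PsiK.
have := @Phi_continuous (sheet_pt x0 1%g).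
rewrite /continuous_at Phix0 => /(_ _ N) PhiN.
apply: (@filterS _ (nbhs (sheet_pt x0 1%g)) _ _ _ _ PhiN) => y [x Qx].
rewrite PhiK => yx.
by exists x.
Qed.

Section Extend.
Variable f : MG -> R[i]^o.
Hypothesis f_bounded : bounded_function f.
Hypothesis f_unif : unif_continuous f.

Lemma sheet_restriction_subproof i (x : U i) : linf (fun h => f (sheet_pt x h)).
Proof. by have [K fK] := f_bounded; exists K. Qed.

Definition sheet_restriction i (x : U i) : linf :=
  in_set_type (sheet_restriction_subproof x).

Definition extension_section i (x : U i) (xi : beta R G) : R[i]^o :=
  \val xi (sheet_restriction x).

Lemma extension_section_compatible :
  bundle_compatible (beta_right_action R G) extension_section.
Proof.
move=> i j x y xi xy; rewrite /extension_section /=; congr (_ _).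
apply: val_inj; apply: funext => h /=; congr (f (Psi _)).
by symmetry; apply/bundle_ptP.
Qed.

(** The difference of the values at [(x0, xi0)] and [(x, xi)] is split at
    [(x0, xi)]: the first part is small by the topology of the fibre, the second
    because [f (x0, h) - f (x, h)] is small uniformly in [h]. *)
Lemma extension_section_continuous i :
  continuous (fun u : U i * beta R G => extension_section u.1 u.2).
Proof.
move=> [x0 xi0]; apply/cvgC_ltP => e e0.
have e2 : 0 < e / 2 by rewrite divr_gt0.
have [d d0 fd] := (metric_unif_continuousP f).1 f_unif _ e2.
have N1 : \forall x \near x0, mdist (sheet_pt x0 1%g) (sheet_pt x 1%g) < d.
  have := @sheet_pt_continuous i 1%g x0.
  by move=> /metricType_numDomainType.cvgrPdist_lt/(_ _ d0).
have N2 : \forall xi \near xi0,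
    `|(\val xi0 (sheet_restriction x0) : R[i]) - \val xi (sheet_restriction x0)|
      < ((e / 2)%:C)%C.
  have idc : continuous (@id (beta R G)) by move=> z; exact: cvg_id.
  have := (maximal_ideal_space_continuousP _).1 idc (sheet_restriction x0) xi0.
  by move/cvgC_ltP => /(_ _ e2).
exists ([set x | mdist (sheet_pt x0 1%g) (sheet_pt x 1%g) < d],
  [set xi | `|(\val xi0 (sheet_restriction x0) : R[i]) -
     \val xi (sheet_restriction x0)| < ((e / 2)%:C)%C]) => //.
move=> [x xi] [/= xd xie]; rewrite /extension_section.
have -> :
  (\val xi0 (sheet_restriction x0) : R[i]) - \val xi (sheet_restriction x) =
    (\val xi0 (sheet_restriction x0) - \val xi (sheet_restriction x0)) +
    (\val xi (sheet_restriction x0) - \val xi (sheet_restriction x)) by ring.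
apply: (le_lt_trans (ler_normD _ _)).
rewrite [ltRHS]split_complex.
apply: ltr_leD => //; apply: beta_dist => h /=; apply: ltW; apply: fd.
by rewrite sheet_pt_dist.
Qed.

Lemma unif_continuous_extends :
  exists F : beta_bundle R c -> R[i]^o,
    continuous F /\ forall y, F (bundle_embed R (Phi y)) = f y.
Proof.
have comp := extension_section_compatible.
exists (bundle_lift extension_section); split.
  apply: bundle_continuous => i.
  rewrite (_ : (fun u => _) =
    (fun u : U i * beta R G => extension_section u.1 u.2)).
    exact: extension_section_continuous.
  by apply: funext => u; rewrite bundle_liftE.
move=> y; have [i [x [h yE]]] := bundle_ptW (Phi y).
rewrite yE -/(group_bundle_pt x h) bundle_embedE bundle_liftE//.
by rewrite /extension_section /= /sheet_pt -[y in RHS]PhiK yE.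
Qed.

End Extend.

Lemma beta_bundle_compact : compact [set: M] -> compact [set: beta_bundle R c].
Proof. by move=> Mc; apply: bundle_compact => //; exact: beta_compact. Qed.

(** Joint continuity of [F] near each point of the compact fibre over [x0] gives
    an estimate that is uniform along the fibre. *)
Lemma fibrewise_near (F : beta_bundle R c -> R[i]^o) i (x0 : U i) (e : R) :
  continuous F -> 0 < e ->
  \forall x \near x0, forall xi : beta R G,
    `|F (beta_bundle_pt x0 xi) - F (beta_bundle_pt x xi)| < (e%:C)%C.
Proof.
move=> Fc e0; have e2 : 0 < e / 2 by rewrite divr_gt0.
have /compact_near_coveringP bc := @beta_compact R G.
pose P (x : U i) xi :=
  `|F (beta_bundle_pt x0 xi) - F (beta_bundle_pt x xi)| < (e%:C)%C :> R[i].
suff H : \forall x \near x0, [set: beta R G] `<=` P x.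
  by apply: (@filterS _ (nbhs x0) _ _ _ _ H) => x xP xi; exact: xP.
apply: (bc _ (nbhs x0) P) => xi _.
have ptc := @bundle_pt_continuous _ _ _ c _ (beta_right_action R G) i (x0, xi).
have /cvgC_ltP/(_ _ e2) := cvg_comp _ _ ptc (Fc _).
move=> [[/= A B] [x0A xiB] AB].
exists (B, A) => // -[xi' x] [/= xiB' xA].
have h1 := AB (x0, xi') (conj (nbhs_singleton x0A) xiB').
have h2 := AB (x, xi') (conj xA xiB').
rewrite /P.
have -> : (F (beta_bundle_pt x0 xi') : R[i]) - F (beta_bundle_pt x xi') =
  (F (beta_bundle_pt x0 xi) - F (beta_bundle_pt x xi')) -
  (F (beta_bundle_pt x0 xi) - F (beta_bundle_pt x0 xi')) by ring.
rewrite [ltRHS]split_complex.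
apply: (le_lt_trans (ler_normB _ _)); apply: ltrD.
  exact: h2.
exact: h1.
Qed.

(** Let [y1] lie over a point near [x0], on the sheet of [h]. The translation by
    [h^-1] brings [y1] to the sheet of [1], and with it every [y2] close to
    [y1], by invariance of the metric. The values at [y1] and [y2] are then
    values of [F] at one point [beta_unit h] of the fibre, over two points close
    to [x0]. *)
Lemma continuous_restricts (F : beta_bundle R c -> R[i]^o) :
  compact [set: M] -> continuous F ->
  @bounded_unif_continuous R MG (fun y => F (bundle_embed R (Phi y))).
Proof.
move=> Mc Fc; split.
  have [K FK] := compact_continuous_bounded (beta_bundle_compact Mc) Fc.
  by exists K => y; exact: FK.
apply/unif_continuousCP => e e0.
have e2 : 0 < e / 2 by rewrite divr_gt0.
(* The points of the base serve as the compact parameter: the estimate for the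
   pairs [u] whose first member lies over [x] holds uniformly for [x] near each
   [x0]. *)
pose P (u : MG * MG) (x : M) := p u.1 = x ->
  `|F (bundle_embed R (Phi u.1)) - F (bundle_embed R (Phi u.2))|
    < (e%:C)%C :> R[i].
suff : \forall u \near entourage, [set: M] `<=` P u.
  by apply: filterS => u uP; exact: (uP (p u.1)).
have /compact_near_coveringP := Mc; apply => x0 _.
have [i [x0u <-]] := chart_ex c x0.
have FN := fibrewise_near x0u Fc e2.
have := sheet_nbhs FN.
move=> /metricType_numDomainType.nbhs_mdistP[r /= r0 rP].
have r2 : 0 < r / 2 by rewrite divr_gt0.
have SN : \forall x \near x0u,
    mdist (sheet_pt x0u 1%g) (sheet_pt x 1%g) < r / 2.
  have := @sheet_pt_continuous i 1%g x0u.
  by move=> /metricType_numDomainType.cvgrPdist_lt/(_ _ r2).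
exists ([set z | forall x : U i, \val x = z ->
     mdist (sheet_pt x0u 1%g) (sheet_pt x 1%g) < r / 2] `&` chart c i,
   [set u | mdist u.1 u.2 < r / 2]).
  split=> /=.
    apply: filterI; first exact: subtype_nbhs.
    by apply: chart_near; exact: chart_val.
  rewrite -entourage_ballE; exists (r / 2) => //= -[y z] /=.
  by rewrite ballEmdist.
move=> [z [y1 y2]] [/= [zr iz] y12] pz /=.
have [h y1E] := @sheet_ptW y1 i (in_set_type iz) pz.
set x1 : U i := in_set_type iz in y1E.
have x1r : mdist (sheet_pt x0u 1%g) (sheet_pt x1 1%g) < r / 2 by exact: zr.
have [x1' Qx1 x1E] : exists2 x : U i, (forall xi,
    `|F (beta_bundle_pt x0u xi) - F (beta_bundle_pt x xi)| < ((e / 2)%:C)%C) &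
    sheet_pt x1 1%g = sheet_pt x 1%g.
  apply: rP => /=; apply: (lt_trans x1r).
  by rewrite ltr_pdivrMr// ltr_pMr// ltr1n.
have {}x1E : x1' = x1.
  by apply: val_inj; rewrite -(sheet_pt_proj x1' 1%g) -x1E sheet_pt_proj.
subst x1'.
have [x2 Qx2 x2E] : exists2 x : U i, (forall xi,
    `|F (beta_bundle_pt x0u xi) - F (beta_bundle_pt x xi)| < ((e / 2)%:C)%C) &
    act h^-1%g y2 = sheet_pt x 1%g.
  apply: rP => /=; rewrite [r]splitr.
  apply: (le_lt_trans (metric_triangle _ (sheet_pt x1 1%g) _)).
  apply: ltrD => //.
  by rewrite -(mulVg h) -act_sheet_pt -y1E d_invariant.
have y2E : y2 = sheet_pt x2 h.
  by rewrite -[y2](act_invK h) x2E act_sheet_pt mulg1.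
rewrite y1E y2E !bundle_embed_sheet_pt [ltRHS]split_complex.
set xi := beta_unit R h.
have -> : (F (beta_bundle_pt x1 xi) : R[i]) - F (beta_bundle_pt x2 xi) =
  (F (beta_bundle_pt x0u xi) - F (beta_bundle_pt x2 xi)) -
  (F (beta_bundle_pt x0u xi) - F (beta_bundle_pt x1 xi)) by ring.
by apply: (le_lt_trans (ler_normB _ _)); apply: ltrD; [exact: Qx2|exact: Qx1].
Qed.

End MetricCovering.

(** * Extension to the bundle and the maximal ideal space *)

Theorem theorem2p1 (R : realType) (n : nat) (M : topologicalType)
    (MG : metricType R) (G : groupType) (p : MG -> M) (act : G -> MG -> MG)
    (I : finType) (c : cocycle G M I) (Phi : MG -> group_bundle c)
    (M_manifold : manifold R n M) (M_compact : compact [set: M])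
    (p_galois : galois_covering p act)
    (d_invariant : forall g x y, mdist (act g x) (act g y) = mdist x y)
    (c_charts : forall i, ball_chart R n (chart c i))
    (Phi_iso : principal_bundle_iso p act Phi) :
  [/\ (forall f : MG -> R[i]^o, bounded_unif_continuous f ->
         exists! F : beta_bundle R c -> R[i]^o,
           continuous F /\ forall y, F (bundle_embed R (Phi y)) = f y),
      [set F : beta_bundle R c -> R[i]^o | continuous F /\
         exists2 f : MG -> R[i]^o, bounded_unif_continuous f &
           forall y, F (bundle_embed R (Phi y)) = f y]
      = [set F : beta_bundle R c -> R[i]^o | continuous F] &
      homeomorphic (beta_bundle R c)
        (maximal_ideal_space (@bounded_unif_continuous R MG))].
Proof.
have [Mh _ _] := M_manifold.
case: Phi_iso => -[Phic [Psi [Psic PhiK PsiK]]] Phi_act.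
pose j y := bundle_embed R (Phi y).
have j_dense (e : beta_bundle R c) :
    exists2 K : set_system MG, ProperFilter K & j @ K --> e.
  have [K KF Ke] := bundle_embed_dense e.
  exists (Psi @ K); first exact: fmap_proper_filter.
  have jPsi : j \o Psi = @bundle_embed R G M I c.
    by apply: funext => y; rewrite /j /= PsiK.
  by move: Ke; rewrite -jPsi.
have extend (f : MG -> R[i]^o) : bounded_unif_continuous f ->
    exists F : beta_bundle R c -> R[i]^o,
      continuous F /\ forall y, F (j y) = f y.
  move=> [fb fu].
  exact: (unif_continuous_extends d_invariant Phi_act Psic PhiK PsiK fb fu).
have restrict (F : beta_bundle R c -> R[i]^o) : continuous F ->
    bounded_unif_continuous (F \o j).
  move=> Fc.
  exact: (continuous_restricts d_invariant Phi_act Phic Psic PhiK PsiK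
    M_compact Fc).
split.
- move=> f /extend[F [Fc Ff]]; exists F; split=> // H [Hc Hf].
  by apply: (dense_continuous_eq j_dense) => // y; rewrite Ff Hf.
- apply/seteqP; split=> [F []//|F Fc]; split=> //.
  by exists (F \o j); first exact: restrict.
- apply: (homeomorphic_maximal_ideal_space _ _ j_dense) => //.
  + exact: beta_bundle_compact.
  + exact: beta_bundle_separated.
Qed.
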